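(* Let $S$ be an antichain-finite semigroup. Then $S$ is periodic, and for every idempotent $e\in E(S)$ the set $\sqrt[\infty]{e}=\{x\in S:\exists n\in\mathbb N\ (x^n=e)\}$ is finite.
   Context: A semigroup is a set endowed with an associative binary operation, written $\langle x,y\rangle\mapsto xy$ (no commutativity is assumed). $\mathbb N$ denotes the set of positive integers. A subset $A$ of a semigroup $S$ is an antichain if $xy\notin\{x,y\}$ for any distinct elements $x,y\in A$. A semigroup $S$ is antichain-finite if it contains no infinite antichain. $E(S)=\{x\in S: xx=x\}$ is the set of idempotents of $S$. A semigroup $S$ is periodic if for every $x\in S$ there exists $n\in\mathbb N$ such that $x^n$ is an idempotent of $S$. *)

(* Defs.v *)
From HB Require Import structures.
From mathcomp Require Import all_boot.
From mathcomp Require Import mathcomp_extra boolp classical_sets functions.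
From mathcomp Require Import cardinality.

Set Implicit Arguments.
Unset Strict Implicit.
Unset Printing Implicit Defensive.

Local Open Scope classical_set_scope.
Local Open Scope group_scope.

(* A semigroup need not have a unit, so the library's [x ^+ n] is unavailable.
   The value at [n = 0] is the dummy [x]; every use below requires [0 < n]. *)
Definition spow (S : semigroupType) (x : S) (n : nat) : S := iterop n *%g x x.

Definition antichain (S : semigroupType) (A : set S) : Prop :=
  forall x y : S, A x -> A y -> x <> y -> x * y <> x /\ x * y <> y.

Definition antichain_finite (S : semigroupType) : Prop :=
  ~ exists A : set S, infinite_set A /\ antichain A.

Definition idempotents (S : semigroupType) : set S := [set x : S | x * x = x].

Definition periodic (S : semigroupType) : Prop :=
  forall x : S, exists n : nat, (0 < n)%N /\ idempotents (spow x n).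

Definition infty_root (S : semigroupType) (e : S) : set S :=
  [set x : S | exists n : nat, (0 < n)%N /\ spow x n = e].

(* Main.v *)
Require Import Defs.
From HB Require Import structures.
From mathcomp Require Import all_boot.
From mathcomp Require Import mathcomp_extra boolp classical_sets functions.
From mathcomp Require Import cardinality.

Set Implicit Arguments.
Unset Strict Implicit.
Unset Printing Implicit Defensive.

(** Antichain-finiteness is used on three explicit antichains.

    If the positive powers of [x] were pairwise distinct they would form an
    infinite antichain, because [x ^ i * x ^ j = x ^ (i + j)] is a power
    different from both factors.  Hence [x ^ i = x ^ j] for some [0 < i < j],
    and some power of [x] is idempotent ([spow_idempotent]).

    For an idempotent [e], absorption between two roots of [e] spreads to
    absorption of [e] itself: [x * y = x] gives [x * y ^ n = x] for all
    [n > 0], and one of these powers of [y] is [e].  Since [e] is a power of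
    [x], it commutes with [x], so the two sides [e * x = x] and [x * e = x] are
    the same condition, which cuts the roots into two classes.
    - Roots with [e * x <> x] are an antichain: any absorption between two of
      them makes [e] fix one of them ([antichain_roots_moved]).
    - Roots with [e * x = x] lie in the maximal subgroup at [e]; in a group
      [x * y = x] or [x * y = y] forces a factor to be the identity, so those
      different from [e] are an antichain ([antichain_roots_fixed]).
    Both antichains are finite, and together with [e] they exhaust the roots. *)

Local Open Scope classical_set_scope.
Local Open Scope group_scope.

Section Powers.
Variable S : semigroupType.
Implicit Types (x y : S) (m n : nat).

Lemma spow1 x : spow x 1 = x.
Proof. by []. Qed.

Lemma spowS x n : (0 < n)%N -> spow x n.+1 = x * spow x n.
Proof. by case: n. Qed.

Lemma spowD x m n : (0 < m)%N -> (0 < n)%N ->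
  spow x (m + n) = spow x m * spow x n.
Proof.
move=> + n0; elim: m => [//|[_ _|m IHm _]]; first by rewrite add1n spowS.
by rewrite addSn spowS// IHm// (spowS x (ltn0Sn m)) mulgA.
Qed.

Lemma mul_spow_absorb x y n : (0 < n)%N -> x * y = x -> x * spow y n = x.
Proof.
move=> + xy; elim: n => [//|[_ _|n IHn _]]; first by rewrite spow1.
by rewrite spowS// mulgA xy IHn.
Qed.

Lemma spow_mul_absorb x y n : (0 < n)%N -> x * y = y -> spow x n * y = y.
Proof.
move=> + xy; elim: n => [//|[_ _|n IHn _]]; first by rewrite spow1.
by rewrite spowS// -mulgA IHn.
Qed.

Lemma spow_mul_fix x y n : (0 < n)%N -> x * y = x -> spow x n * y = spow x n.
Proof.
by case: n => [//|[//|n]] _ xy; rewrite -[n.+2]addn1 spowD// -mulgA xy.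
Qed.

Lemma mul_spow_fix x y n : (0 < n)%N -> x * y = y -> x * spow y n = spow y n.
Proof. by case: n => [//|[//|n]] _ xy; rewrite spowS// mulgA xy. Qed.

Lemma spow_comm x n : (0 < n)%N -> x * spow x n = spow x n * x.
Proof. by move=> n0; rewrite -spowS// -addn1 spowD. Qed.

(** With [p := j - i], the powers of [x] are [p]-periodic from exponent [i] on;
    the exponent [i * p] is beyond [i] and a multiple of the period, so doubling
    it does not change the power. *)
Lemma spow_idempotent x i j : (0 < i < j)%N -> spow x i = spow x j ->
  idempotents (spow x (i * (j - i))).
Proof.
move=> /andP[i0 ij] xij; set p := (j - i)%N.
have p0 : (0 < p)%N by rewrite subn_gt0.
have step m : (i <= m)%N -> spow x (m + p) = spow x m.
  rewrite leq_eqVlt => /predU1P[<-|im]; first by rewrite subnKC// ltnW.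
  rewrite -(subnK (ltnW im)) -addnA subnKC; last exact: ltnW.
  by rewrite !spowD ?subn_gt0 ?xij// (ltn_trans i0).
have steps k m : (i <= m)%N -> spow x (m + k * p) = spow x m.
  move=> im; elim: k => [|k IHk]; first by rewrite mul0n addn0.
  by rewrite mulSn addnCA addnC step ?IHk// (leq_trans im)// leq_addr.
by rewrite /idempotents/= -spowD ?muln_gt0 ?i0// steps// leq_pmulr.
Qed.

Lemma antichain_powers x : {in [pred n | 0 < n]%N &, injective (spow x)} ->
  antichain [set spow x n.+1 | n in [set: nat]].
Proof.
move=> inj _ _ [m _ <-] [n _ <-] _; rewrite -spowD//.
split=> /inj; rewrite !inE => /(_ isT isT).
  by rewrite -[RHS]addn0 => /addnI.
by rewrite -[RHS]add0n => /addIn.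
Qed.

Lemma antichain_finite_finite (A : set S) :
  antichain_finite S -> antichain A -> finite_set A.
Proof. by move=> hS antiA; apply: contrapT => infA; apply: hS; exists A. Qed.

Lemma antichain_finite_periodic : antichain_finite S -> periodic S.
Proof.
move=> hS x.
suff [i [j [ij xij]]] : exists i j, (0 < i < j)%N /\ spow x i = spow x j.
  exists (i * (j - i))%N; split; last exact: spow_idempotent.
  by case/andP: ij => i0 ij; rewrite muln_gt0 i0 subn_gt0.
apply: contrapT => distinct.
have inj : {in [pred n | 0 < n]%N &, injective (spow x)}.
  move=> i j; rewrite !inE => i0 j0 xij.
  by case: (ltngtP i j) => // ij; case: distinct;
    [exists i, j|exists j, i]; rewrite ?i0 ?j0.
apply: infinite_nat; rewrite -(@eq_finite_set _ _ [set spow x n.+1 | n in setT]).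
  exact: antichain_finite_finite (antichain_powers inj).
by apply: inj_card_eq => m n _ _ /inj; rewrite !inE => /(_ isT isT) [].
Qed.

End Powers.

Section Roots.
Variables (S : semigroupType) (e : S).
Implicit Types x y : S.

Lemma root_comm x : infty_root e x -> x * e = e * x.
Proof. by move=> [n [n0 <-]]; exact: spow_comm. Qed.

Lemma absorb_root x y : infty_root e y -> x * y = x -> x * e = x.
Proof. by move=> [n [n0 <-]]; exact: mul_spow_absorb. Qed.

Lemma root_absorb x y : infty_root e x -> x * y = y -> e * y = y.
Proof. by move=> [n [n0 <-]]; exact: spow_mul_absorb. Qed.

(** By [absorb_root] and [root_absorb], [x * y = x] makes [e] fix [x] on the
    right and [x * y = y] makes it fix [y] on the left; for roots the side does
    not matter. *)
Lemma antichain_roots_moved :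
  antichain [set x | infty_root e x /\ e * x <> x].
Proof.
move=> x y [ex exx] [ey eyy] _; split=> xy.
  by apply: exx; rewrite -root_comm// (absorb_root ey).
exact/eyy/(root_absorb ex).
Qed.

(** Multiplying [x * y = x] on the left by a power of [x] turns [x] into [e],
    giving [e * y = e]; on these roots [e * y = y], whence [y = e].
    The case [x * y = y] is the mirror image, where [x * e = e] meets
    [x * e = e * x = x]. *)
Lemma antichain_roots_fixed :
  antichain [set x | [/\ infty_root e x, e * x = x & x <> e]].
Proof.
move=> x y [ex exx xe] [ey eyy ye] _; split=> xy.
  by apply: ye; rewrite -eyy; case: ex => n [n0 <-]; exact: spow_mul_fix.
apply: xe; rewrite -exx -root_comm//.
by case: ey => n [n0 <-]; exact: mul_spow_fix.
Qed.

End Roots.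

Theorem proposition1 (S : semigroupType) (hS : antichain_finite S) :
  periodic S /\ forall e : S, idempotents e -> finite_set (infty_root e).
Proof.
split=> [|e _]; first exact: antichain_finite_periodic.
apply: (@sub_finite_set _ _ (
    [set x | infty_root e x /\ e * x <> x] `|`
    [set x | [/\ infty_root e x, e * x = x & x <> e]] `|` [set e])).
  move=> x ex; have [->|xe] := pselect (x = e); first by right.
  by left; have [exx|exx] := pselect (e * x = x); [right|left].
rewrite !finite_setU; split; last exact: finite_set1; split.
  exact: antichain_finite_finite (@antichain_roots_moved S e).
exact: antichain_finite_finite (@antichain_roots_fixed S e).
Qed.
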